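(* Let $n\ge 2$ and let $A\in M_n(\mathbb{C})$ be a unitarily irreducible matrix with base curve $\Gamma_F$. Then $k(A)=n$ if and only if $\Gamma_F$ has two distinct real points $P$ and $Q$ that are collinear with the origin and satisfy $\operatorname{ord}_P(\Gamma_F)+\operatorname{ord}_Q(\Gamma_F)=n$.
   Context: For $A\in M_n(\mathbb{C})$, the numerical range is $W(A)=\{\langle A\mathbf{x},\mathbf{x}\rangle : \mathbf{x}\in\mathbb{C}^n,\ \|\mathbf{x}\|=1\}\subset\mathbb{C}$. The Gau--Wu number $k(A)$ is the maximum size of an orthonormal set $\{\mathbf{x}_1,\dots,\mathbf{x}_k\}\subset\mathbb{C}^n$ such that every $\langle A\mathbf{x}_j,\mathbf{x}_j\rangle$ lies on the boundary $\partial W(A)$. $A$ is unitarily irreducible if it is not unitarily similar to a block diagonal matrix with at least two diagonal blocks (equivalently, $A$ and $A^*$ have no common nontrivial proper invariant subspace). Let $H_1=(A+A^* )/2$ and $H_2=(A-A^* )/(2i)$. The base polynomial is $F(x:y:t)=F_A(x:y:t)=\det(xH_1+yH_2+tI_n)$, homogeneous of degree $n$, and the base curve $\Gamma_F$ is the curve $F(x:y:t)=0$ in $\mathbb{CP}^2$. The order $\operatorname{ord}_P(\Gamma_F)$ of $\Gamma_F$ at a point $P$ of the curve is the order of vanishing (multiplicity) of $F$ at $P$, so it equals $1$ exactly when $P$ is a nonsingular point. A real point is a point of $\mathbb{CP}^2$ having real homogeneous coordinates. The origin is the point $(0:0:1)$. *)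

(* Defs.v *)
From HB Require Import structures.
From mathcomp Require Import all_boot all_order all_algebra spectral.
(* The notations of mpoly clash with those of the analysis library. *)
From mathcomp Require Import -(notations) mpoly.
From mathcomp Require Import boolp classical_sets reals topology normedtype.
From mathcomp Require Export complex.
Import Order.TTheory GRing.Theory Num.Theory.
Import numFieldNormedType.Exports.

Set Implicit Arguments.
Unset Strict Implicit.
Unset Printing Implicit Defensive.

Local Open Scope ring_scope.
Local Open Scope sesquilinear_scope.
Local Open Scope classical_set_scope.

(* Everything is defined over an abstract [C : numClosedFieldType], whose norm
   topology is the one provided by the library; for [R : realType] the field of
   complex numbers is the instance [R[i]]. *)

Section InnerProduct.
Variables (C : numClosedFieldType) (n : nat).

(* [dotmx] is the standard Hermitian product on row vectors, linear in its
   first argument and conjugate-linear in the second. *)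
Definition inner (u v : 'cV[C]_n) : C := dotmx u^T v^T.

Definition vnorm (u : 'cV[C]_n) : C := sqrtC (inner u u).

Definition orthonormal k (x : 'I_k -> 'cV[C]_n) : Prop :=
  forall i j, inner (x i) (x j) = (i == j)%:R.

Lemma orthonormal_leq k (x : 'I_k -> 'cV[C]_n) : orthonormal x -> (k <= n)%N.
Proof.
move=> ox; pose M : 'M[C]_(k, n) := \matrix_(i, j) x i j 0.
have uM : M \is unitarymx.
  apply/unitarymxP/matrixP => i j; rewrite [RHS]mxE -ox /inner dotmxE !mxE.
  by apply: eq_bigr => l _; rewrite !mxE.
by rewrite -(mxrank_unitary uM) rank_leq_col.
Qed.

End InnerProduct.

Definition boundary (T : topologicalType) (S : set T) : set T :=
  closure S `\` interior S.

Section GauWu.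
Variables (C : numClosedFieldType) (n : nat).
Implicit Type A : 'M[C]_n.

Definition numerical_range A : set C :=
  [set inner (A *m x) x | x in [set x : 'cV[C]_n | vnorm x = 1]].

Definition boundary_family A k (x : 'I_k -> 'cV[C]_n) : Prop :=
  orthonormal x /\
  forall j, boundary (numerical_range A) (inner (A *m x j) (x j)).

Definition has_boundary_family A (k : nat) : bool :=
  `[< exists x : 'I_k -> 'cV[C]_n, boundary_family A x >].

Lemma ex_boundary_family A : exists k, has_boundary_family A k.
Proof.
by exists 0%N; apply/asboolP; exists (fun=> 0); split=> [[]|[]].
Qed.

Lemma boundary_family_leq A k : has_boundary_family A k -> (k <= n)%N.
Proof. by move=> /asboolP[x [/orthonormal_leq]]. Qed.

Definition gau_wu_number A : nat :=
  ex_maxn (ex_boundary_family A) (@boundary_family_leq A).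

(* The condition [\sum_i p_ i = n] makes the rectangular-looking [U] square, so
   that [unitarymx] (which says [U *m U^t* = 1]) means that [U] is unitary. *)
Definition unitarily_reducible A : Prop :=
  exists (k : nat) (p_ : 'I_k -> nat) (B : forall i, 'M[C]_(p_ i))
         (U : 'M[C]_(n, \sum_i p_ i)),
    [/\ (2 <= k)%N, forall i, (0 < p_ i)%N, (\sum_i p_ i = n)%N,
        U \is unitarymx & A = U *m (\mxdiag_i B i) *m U^t*].

Definition unitarily_irreducible A : Prop := ~ unitarily_reducible A.

End GauWu.

Section VanishingOrder.
Variables (C : comNzRingType) (k : nat).

Definition taylor_shift (p : mpoly k C) (v : 'rV[C]_k) : mpoly k C :=
  comp_mpoly
    [tuple mpolyX C (mnm1 i) + mpolyC k (v 0 i) | i < k] p.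

(* The least degree of a monomial of [p (v + X)], for [p != 0]; all these
   degrees are below [msize], which only serves as neutral element of [minn]. *)
Definition vanishing_order (p : mpoly k C) (v : 'rV[C]_k) : nat :=
  let q := taylor_shift p v in
  \big[minn/msize q]_(m <- msupp q) mdeg m.

End VanishingOrder.

(* A point of the complex projective plane is given by homogeneous coordinates
   [(x : y : t)], i.e. by a nonzero vector of ['rV[C]_3], two such vectors
   representing the same point when they are proportional. *)
Section ProjectivePlane.
Variable C : numClosedFieldType.
Implicit Types P Q O : 'rV[C]_3.

Definition is_point P : Prop := P != 0.

Definition same_point P Q : Prop := exists2 c : C, c != 0 & Q = c *: P.

Definition real_point P : Prop :=
  exists2 c : C, c != 0 & c *: P \is a mxOver Num.real.

Definition collinear O P Q : Prop :=
  exists2 l : 'cV[C]_3, l != 0 & [/\ O *m l = 0, P *m l = 0 & Q *m l = 0].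

Definition origin : 'rV[C]_3 := \row_(j < 3) (j == ord_max)%:R.

End ProjectivePlane.

Arguments origin {C}.

Section BaseCurve.
Variables (C : numClosedFieldType) (n : nat).
Implicit Type A : 'M[C]_n.

Definition hermitian_re A : 'M[C]_n := 2^-1 *: (A + A^t*).
Definition hermitian_im A : 'M[C]_n := (2 * 'i)^-1 *: (A - A^t*).

Definition base_poly A : mpoly 3 C :=
  let X (j : 'I_3) := mpolyX C (mnm1 j) in
  let const (M : 'M[C]_n) := map_mx (@mpolyC 3 C) M in
  \det (X 0 *: const (hermitian_re A) + X 1 *: const (hermitian_im A)
        + X 2 *: const 1%:M).

Definition on_base_curve A (P : 'rV[C]_3) : Prop :=
  is_point P /\ meval (P 0) (base_poly A) = 0.

(* The multiplicity of the homogeneous polynomial [base_poly A] at a vector of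
   homogeneous coordinates of [P]; it does not depend on the vector and agrees
   with the multiplicity computed in an affine chart. *)
Definition ord_base_curve A (P : 'rV[C]_3) : nat :=
  vanishing_order (base_poly A) P.

End BaseCurve.

(* Main.v *)
(** For a real direction [(c, s)], the maximum and the minimum of
    [c * 'Re z + s * 'Im z] over the numerical range are the extreme eigenvalues
    of the Hermitian matrix [c H1 + s H2], and a unit vector whose value lies on
    a supporting line is an eigenvector for the extreme eigenvalue.  If an
    orthonormal basis takes its values on the boundary and [A] is irreducible,
    all the supporting lines are parallel, so that a single [c H1 + s H2] has at
    most two eigenvalues [l] and [m], which are distinct by irreducibility.  At
    a point [(c : s : - l)] the order of the base curve is the multiplicity of
    the eigenvalue [l], whence the points [(c : s : - l)] and [(c : s : - m)].
    Conversely two such points provide an orthonormal basis of eigenvectors of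
    [c H1 + s H2] with extreme eigenvalues. *)

Require Import Defs.
From mathcomp Require Import all_boot all_order all_algebra spectral.
From mathcomp Require Import -(notations) mpoly.
From mathcomp Require Import boolp classical_sets reals topology normedtype.
From mathcomp Require Import complex.
From mathcomp Require Import ring lra.
Import Order.TTheory GRing.Theory Num.Theory.
Import numFieldNormedType.Exports.

Set Implicit Arguments.
Unset Strict Implicit.
Unset Printing Implicit Defensive.

Local Open Scope classical_set_scope.
Local Open Scope ring_scope.
Local Open Scope sesquilinear_scope.

(** * Inner products and reducibility *)

Section Inner.
Variables (C : numClosedFieldType) (n : nat).
Implicit Types (A B V : 'M[C]_n) (x y z u v : 'cV[C]_n) (a : C).

Lemma innerE u v : inner u v = \sum_k u k 0 * (v k 0)^*.
Proof. by rewrite /inner dotmxE !mxE; apply: eq_bigr => k _; rewrite !mxE. Qed.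

Lemma innerDl x y z : inner (x + y) z = inner x z + inner y z.
Proof. by rewrite !innerE -big_split; apply: eq_bigr => k _; rewrite mxE mulrDl. Qed.

Lemma innerZl a x y : inner (a *: x) y = a * inner x y.
Proof. by rewrite !innerE mulr_sumr; apply: eq_bigr => k _; rewrite mxE mulrA. Qed.

Lemma inner_conj x y : (inner x y)^* = inner y x.
Proof.
rewrite !innerE rmorph_sum; apply: eq_bigr => k _.
by rewrite rmorphM /= conjCK mulrC.
Qed.

Lemma innerDr x y z : inner x (y + z) = inner x y + inner x z.
Proof. by rewrite -inner_conj innerDl rmorphD /= !inner_conj. Qed.

Lemma innerZr a x y : inner x (a *: y) = a^* * inner x y.
Proof. by rewrite -inner_conj innerZl rmorphM /= inner_conj. Qed.

Lemma innerNl x y : inner (- x) y = - inner x y.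
Proof. by rewrite -scaleN1r innerZl mulN1r. Qed.

Lemma inner_ge0 x : 0 <= inner x x.
Proof. by rewrite innerE sumr_ge0 // => k _; rewrite mul_conjC_ge0. Qed.

Lemma inner_eq0 x : inner x x = 0 -> x = 0.
Proof.
rewrite innerE => /eqP; rewrite psumr_eq0 => [/allP x0|k _]; last first.
  exact: mul_conjC_ge0.
apply/matrixP => k j; rewrite ord1 mxE; apply/eqP.
by rewrite -mul_conjC_eq0; apply: x0; rewrite mem_index_enum.
Qed.

Lemma inner_adjoint A x y : inner (A *m x) y = inner x (A^t* *m y).
Proof.
rewrite !innerE; under eq_bigr do rewrite mxE mulr_suml.
rewrite exchange_big; apply: eq_bigr => k _; rewrite mxE rmorph_sum mulr_sumr.
by apply: eq_bigr => l _; rewrite !mxE rmorphM /= conjCK mulrCA mulrA.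
Qed.

Lemma inner_trmxC A x y : inner (A^t* *m x) y = (inner (A *m y) x)^*.
Proof. by rewrite inner_conj inner_adjoint trmxCK. Qed.

Lemma vnorm_eq1 x : (vnorm x = 1) <-> (inner x x = 1).
Proof.
rewrite /vnorm; split=> [nx|->]; last exact: sqrtC1.
by rewrite -[LHS]sqrtCK nx expr1n.
Qed.

Lemma inner_hermitian_re A x y :
  inner (hermitian_re A *m x) y = (inner (A *m x) y + (inner (A *m y) x)^*) / 2.
Proof. by rewrite -scalemxAl innerZl mulmxDl innerDl inner_trmxC mulrC. Qed.

Lemma inner_hermitian_im A x y :
  inner (hermitian_im A *m x) y = (inner (A *m x) y - (inner (A *m y) x)^*) / (2 * 'i).
Proof. by rewrite -scalemxAl innerZl mulmxBl innerDl innerNl inner_trmxC mulrC. Qed.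

Lemma inner_decomp A x y : inner (A *m x) y =
  inner (hermitian_re A *m x) y + 'i * inner (hermitian_im A *m x) y.
Proof.
rewrite inner_hermitian_re inner_hermitian_im.
have i0 := neq0Ci C; field.
exact: i0.
Qed.

Lemma inner_hermitian_re_conj A x y :
  (inner (hermitian_re A *m x) y)^* = inner (hermitian_re A *m y) x.
Proof.
rewrite !inner_hermitian_re rmorphM rmorphD fmorphV /= conjCK conjC_nat.
by rewrite addrC.
Qed.

Lemma inner_hermitian_im_conj A x y :
  (inner (hermitian_im A *m x) y)^* = inner (hermitian_im A *m y) x.
Proof.
rewrite !inner_hermitian_im rmorphM rmorphB fmorphV rmorphM /= conjCK conjC_nat.
by rewrite conjCi mulrN invrN mulrN -mulNr opprB.
Qed.

Lemma inner_hermitian_re_diag A x :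
  inner (hermitian_re A *m x) x = 'Re (inner (A *m x) x).
Proof. by rewrite inner_hermitian_re ReE. Qed.

Lemma inner_hermitian_im_diag A x :
  inner (hermitian_im A *m x) x = 'Im (inner (A *m x) x).
Proof.
rewrite inner_hermitian_im invfM invCi -[RHS]opprK.
rewrite mulrA mulrN; congr (- _).
by rewrite ImE; field.
Qed.

Lemma inner_row A V i j :
  inner (A *m (row j V)^t* ) ((row i V)^t* ) = (V *m A *m V^t* ) i j.
Proof.
rewrite innerE -mulmxA [RHS]mxE; apply: eq_bigr => k _.
rewrite [LHS]mulrC !mxE conjCK; congr (_ * _).
by apply: eq_bigr => l _; rewrite !mxE.
Qed.

End Inner.

(** * Block diagonal form from a partition of an orthonormal basis *)

Section Partition.
Variables (C : numClosedFieldType) (n : nat).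

Lemma colsub_rowsub (T : pzSemiRingType) (m p q r : nat) (f : 'I_q -> 'I_n) 
  (M : 'M[T]_(p, n)) (N : 'M[T]_(n, r)) :
  bijective f -> colsub f M *m rowsub f N = M *m N.
Proof.
move=> bf; apply/matrixP => i j; rewrite !mxE [RHS](reindex f) /=; last first.
  exact: onW_bij.
by apply: eq_bigr => k _; rewrite !mxE.
Qed.

(** Listing the fibres of [g] one after another permutes the rows of [V]; entries outside the
    resulting diagonal blocks link different fibres, hence vanish. *)
Lemma unitarily_reducible_of_partition (A V : 'M[C]_n) (k : nat) (g : 'I_n -> 'I_k) :
  (2 <= k)%N -> (forall i, exists j, g j = i) -> V \is unitarymx ->
  (forall i j, g i != g j -> (V *m A *m V^t* ) i j = 0) -> unitarily_reducible A.
Proof.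
move=> k2 gsurj uV VAV; pose p_ i := #|[pred j | g j == i]|.
pose f (c : 'I_(\sum_i p_ i)) := enum_val (tagnat.sig2 c).
have gf c : g (f c) = tagnat.sig1 c by have := enum_valP (tagnat.sig2 c); rewrite inE => /eqP.
have sp : (\sum_i p_ i = n)%N.
  rewrite -[RHS]card_ord -sum1_card (partition_big g predT) //=.
  by apply: eq_bigr => i _; rewrite /p_ -sum1_card.
have bf : bijective f.
  apply: inj_card_bij; last by rewrite !card_ord sp.
  have finj (s t : {i : 'I_k & 'I_(p_ i)}) :
      enum_val (tagged s) = enum_val (tagged t) :> 'I_n -> s = t.
    move: s t => [i a] [j b] /= ab.
    have : i = j.
      have := enum_valP a; rewrite ab inE => /eqP <-.
      by have := enum_valP b; rewrite inE => /eqP.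
    by move=> eij; subst j; rewrite (enum_val_inj ab).
  move=> c c' fcc'; apply: (bij_inj tagnat.sig_bij).
  by apply: finj; rewrite !tagnat.sigE12.
pose M := V *m A *m V^t*.
have VV : V^t* *m V = 1%:M.
  by move: uV; rewrite -trmxC_unitary => /unitarymxP; rewrite trmxCK.
exists k, p_, (fun i => submxblock (mxsub f f M) i i), (colsub f (V^t* )).
have Ut : (colsub f (V^t* ))^t* = rowsub f V.
  by apply/matrixP => i j; rewrite !mxE conjCK.
split=> //.
- move=> i; have [j gj] := gsurj i; apply/card_gt0P; exists j.
  by rewrite inE gj.
- by apply/unitarymxP; rewrite Ut colsub_rowsub.
rewrite Ut.
have <- : mxsub f f M = \mxdiag_i submxblock (mxsub f f M) i i.
  rewrite -[LHS]submxblockK; apply: eq_mxblock => i j.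
  case: eqP => [<-|/eqP ij]; first by rewrite conform_mx_id.
  apply/matrixP => a b; rewrite mxE [RHS]mxE mxE; apply: VAV.
  by rewrite !gf !tagnat.Rank1K.
have -> : mxsub f f M = rowsub f (colsub f M) by apply/matrixP => ? ?; rewrite !mxE.
rewrite colsub_rowsub // mulmx_colsub colsub_rowsub //.
by rewrite /M !mulmxA VV mul1mx -mulmxA VV mulmx1.
Qed.

End Partition.

(** * Orders of points of the base curve *)

Section VanishingOrder.
Variables (C : idomainType) (k : nat).
Implicit Types p q : mpoly k C.

(** The zero polynomial satisfies this for every [d], so sums need no care about cancellation. *)
Definition order_ge (d : nat) p := forall m, m \in msupp p -> (d <= mdeg m)%N.

Lemma order_ge_sum d (I : Type) (r : seq I) (P : pred I) (F : I -> mpoly k C) :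
  (forall i, P i -> order_ge d (F i)) -> order_ge d (\sum_(i <- r | P i) F i).
Proof.
move=> Fd; apply: big_ind => //; first by move=> m; rewrite msupp0.
by move=> p q dp dq m /msuppD_le; rewrite mem_cat => /orP[/dp|/dq].
Qed.

Lemma order_geM d e p q : order_ge d p -> order_ge e q -> order_ge (d + e) (p * q).
Proof.
move=> dp eq m /msuppM_le /allpairsP[[m1 m2] /= [/dp dm1 /eq em2 ->]].
by rewrite mdegD leq_add.
Qed.

Lemma order_ge_prod (I : finType) (d : I -> nat) (F : I -> mpoly k C) :
  (forall i, order_ge (d i) (F i)) -> order_ge (\sum_i d i) (\prod_i F i).
Proof. by move=> Fd; apply: (big_ind2 order_ge) => // *; exact: order_geM. Qed.

Lemma order_geX i : order_ge 1 (mpolyX C (mnm1 i) : mpoly k C).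
Proof. by move=> m; rewrite msuppX inE => /eqP ->; rewrite mdeg1. Qed.

Lemma vanishing_orderP p (v : 'rV[C]_k) d :
  order_ge d (taylor_shift p v) -> ~ order_ge d.+1 (taylor_shift p v) ->
  vanishing_order p v = d.
Proof.
rewrite /vanishing_order; set q := taylor_shift p v => dq dSq.
have [m mq md] : exists2 m, m \in msupp q & (mdeg m <= d)%N.
  apply: contra_notP dSq => nm m mq; rewrite ltnNge; apply/negP => md.
  by apply: nm; exists m.
apply/eqP; rewrite eqn_leq; apply/andP; split.
  apply: leq_trans md; elim: (msupp q : seq _) mq => // m' r IH.
  rewrite inE big_cons => /predU1P[<-|/IH mr]; first exact: geq_minl.
  exact: leq_trans (geq_minr _ _) mr.
rewrite big_seq; apply: (big_ind (fun e => (d <= e)%N)) => // [|e f de df].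
  (* The default value [msize q] exceeds the degree of the monomial [m], so it is at least [d]
     too. *)
  by rewrite ltnW // (leq_ltn_trans (dq _ mq)) // msize_mdeg_lt.
by rewrite leq_min de df.
Qed.

(** Substituting polynomials without constant term cannot lower the order; restricting to a line
    thus bounds the order of [p] from above. *)
Lemma dvdp_mmap (h : 'I_k -> {poly C}) d p :
  (forall i, 'X %| h i) -> order_ge d p -> 'X^d %| mmap polyC h p.
Proof.
move=> Xh dp; rewrite /mmap big_seq; apply: (big_ind (fun r => 'X^d %| r)).
- exact: dvdp0.
- by move=> r s; exact: dvdp_add.
move=> m /dp dm; apply: dvdp_mull; apply: (@dvdp_trans _ 'X^(mdeg m)).
  by rewrite -(subnK dm) exprD dvdp_mull.
rewrite mdegE expr_sum /mmap1; apply: (big_ind2 (fun r s : {poly C} => r %| s)) => //.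
  by move=> *; exact: dvdp_mul.
by move=> i _; exact: dvdp_exp2r.
Qed.

End VanishingOrder.

Section MatrixConjugation.
Variables (T : comPzRingType) (n : nat).
Implicit Types (V W M : 'M[T]_n) (x : T).

Lemma mulmx_affine_conj V W M0 M1 M2 M3 x1 x2 x3 :
  V *m (M0 + (x1 *: M1 + x2 *: M2 + x3 *: M3)) *m W =
  V *m M0 *m W + (x1 *: (V *m M1 *m W) + x2 *: (V *m M2 *m W)
    + x3 *: (V *m M3 *m W)).
Proof. by rewrite !mulmxDr !mulmxDl -!scalemxAr -!scalemxAl. Qed.

Lemma det_conj V W M : V *m W = 1%:M -> \det M = \det (V *m M *m W).
Proof. by move=> VW; rewrite !det_mulmx mulrAC -det_mulmx VW det1 mul1r. Qed.

End MatrixConjugation.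

Section BaseCurveOrder.
Variables (C : numClosedFieldType) (n : nat).
Implicit Types (A V : 'M[C]_n) (P : 'rV[C]_3) (D : 'rV[C]_n).

Definition pencil A P : 'M[C]_n :=
  P 0 0 *: hermitian_re A + P 0 1 *: hermitian_im A + (P 0 2)%:M.

Lemma meval_base_poly A P : meval (P 0) (base_poly A) = \det (pencil A P).
Proof.
rewrite /base_poly -det_map_mx; congr (\det _); apply/matrixP => i j.
by rewrite !mxE /= !(mevalD, mevalM, mevalXU, mevalC) mulr_natr.
Qed.

Lemma taylor_shift_base_poly A P :
  taylor_shift (base_poly A) P =
  \det (map_mx (@mpolyC 3 C) (pencil A P)
        + (mpolyX C (mnm1 0) *: map_mx (@mpolyC 3 C) (hermitian_re A)
        + mpolyX C (mnm1 1) *: map_mx (@mpolyC 3 C) (hermitian_im A)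
        + mpolyX C (mnm1 2) *: map_mx (@mpolyC 3 C) 1%:M)).
Proof.
rewrite /taylor_shift /base_poly -det_map_mx; congr (\det _); apply/matrixP => i j.
have compX (lq : 3.-tuple (mpoly 3 C)) l : comp_mpoly lq (mpolyX C (mnm1 l)) = tnth lq l.
  by rewrite /comp_mpoly mmapX mmap1U.
have compM (lq : 3.-tuple (mpoly 3 C)) p q :
  comp_mpoly lq (p * q) = comp_mpoly lq p * comp_mpoly lq q := rmorphM _ p q.
rewrite !mxE /=; set a := 2^-1 * _; set b := (2 * 'i)^-1 * _.
rewrite !(comp_mpolyD, compM, comp_mpolyC, compX) !tnth_mktuple.
clearbody a b; rewrite -(mulr_natr (P 0 2) (i == j)) !(mpolyCD, mpolyCM).
have expand (T : pzRingType) (x0 x1 x2 c0 c1 c2 r0 r1 r2 : T) :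
    (x0 + c0) * r0 + (x1 + c1) * r1 + (x2 + c2) * r2 =
    c0 * r0 + c1 * r1 + c2 * r2 + (x0 * r0 + x1 * r1 + x2 * r2).
  by rewrite !mulrDl (addrACA (x0 * r0)) [LHS]addrACA addrC.
exact: expand.
Qed.

(* Each of the [#|D_i = 0|] rows of [N] without constant term contributes a linear
   form to every term of the Leibniz expansion, and along the direction of the
   origin the determinant is [\prod_i (D_i + t)], of order exactly [#|D_i = 0|]. *)
Lemma ord_base_curveE A P V D : V \is unitarymx ->
  V *m pencil A P *m V^t* = diag_mx D ->
  ord_base_curve A P = #|[pred i | D 0 i == 0]|.
Proof.
move=> uV VAP; pose c := @mpolyC 3 C.
pose N : 'M[mpoly 3 C]_n := map_mx c (diag_mx D)
        + (mpolyX C (mnm1 0) *: map_mx c (V *m hermitian_re A *m V^t* )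
        + mpolyX C (mnm1 1) *: map_mx c (V *m hermitian_im A *m V^t* )
        + mpolyX C (mnm1 2) *: map_mx c 1%:M).
have cVV : map_mx c V *m map_mx c (V^t* ) = 1%:M.
  by rewrite -map_mxM (unitarymxP uV) map_mx1.
have qE : taylor_shift (base_poly A) P = \det N.
  have cVMV M : map_mx c V *m map_mx c M *m map_mx c (V^t* ) = map_mx c (V *m M *m V^t* ).
    by rewrite !map_mxM.
  apply: etrans (taylor_shift_base_poly A P) _.
  apply: etrans (det_conj _ cVV) _.
  apply: (congr1 determinant).
  apply: etrans (mulmx_affine_conj _ _ _ _ _ _ _ _ _) _.
  rewrite /N; congr (_ + (_ *: _ + _ *: _ + _ *: _)).
  - by rewrite -VAP cVMV.
  - exact: cVMV.
  - exact: cVMV.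
  by rewrite cVMV mulmx1 (unitarymxP uV).
apply: vanishing_orderP; rewrite qE.
  rewrite -sum1_card big_mkcond /=.
  apply: order_ge_sum => s _; rewrite -[X in order_ge X _]add0n.
  apply: order_geM => //; apply: order_ge_prod => i.
  case: ifPn => // /eqP Di0; rewrite !mxE Di0 mul0rn /c mpolyC0 add0r.
  have XM j r : order_ge 1 (mpolyX C (mnm1 j) * r : mpoly 3 C).
    by rewrite -[X in order_ge X]addn0; apply: order_geM => //; exact: order_geX.
  by move=> m /msuppD_le; rewrite mem_cat => /orP[/msuppD_le|/XM//];
     rewrite mem_cat => /orP[]/XM.
pose h (j : 'I_3) : {poly C} := if j == 2 then 'X else 0.
have Xh j : 'X %| h j by rewrite /h; case: ifP.
move=> /(dvdp_mmap Xh); apply/negP.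
suff -> : mmap polyC h (\det N) = \prod_i ((D 0 i)%:P + 'X).
  (* Each zero entry of [D] contributes a factor ['X], and the other factors do not vanish at 0, so
     no further power of ['X] divides the product. *)
  rewrite (bigID [pred i | D 0 i == 0]) /=.
  rewrite (eq_bigr (fun=> 'X)) => [|i /eqP ->]; last by rewrite add0r.
  rewrite prodr_const exprSr dvdp_mul2l ?expf_neq0 ?polyX_eq0 //.
  rewrite -{1}['X]subr0 dvdp_XsubCl /root horner_prod.
  by apply/prodf_neq0 => i Di; rewrite hornerD hornerC hornerX addr0.
rewrite -det_map_mx.
have -> : map_mx (mmap polyC h) N = diag_mx (\row_i ((D 0 i)%:P + 'X)).
  apply/matrixP => i j.
  rewrite !mxE !(mmapD, rmorphM) /= !mmapX !mmap1U !mmapC.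
  rewrite /h /= !mul0r !add0r polyCMn mulrnDl; congr (_ + _).
  by case: (i == j); rewrite /= (mulr1n, mulr0n) (mulr1, mulr0).
by rewrite det_diag; apply: eq_bigr => i _; rewrite mxE.
Qed.

End BaseCurveOrder.

(** * Convexity and supporting lines *)

Section PlanarSeparation.
Variable R : realType.
Implicit Type S : R -> R -> Prop.

Definition convex_rel S := forall a b c d t : R, S a b -> S c d -> 0 <= t <= 1 ->
  S ((1 - t) * a + t * c) ((1 - t) * b + t * d).

(** The bounding line passes through the origin, to which the boundary point under study is
    translated beforehand. *)
Definition has_support S := exists c s : R, (c != 0) || (s != 0) /\
  forall a b, S a b -> 0 <= c * a + s * b.

Lemma convex_rel_segment S q r x : convex_rel S -> S (- q) 0 -> S r 0 ->
  0 < q -> 0 < r -> - q <= x <= r -> S x 0.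
Proof.
move=> cS Sq Sr q0 r0 /andP[qx xr]; have qr : 0 < q + r by exact: addr_gt0.
pose t := (x + q) / (q + r).
have t01 : 0 <= t <= 1.
  apply/andP; split; last by rewrite ler_pdivrMr //; lra.
  by rewrite divr_ge0 //; [lra | exact: ltW].
have := cS _ _ _ _ _ Sq Sr t01; rewrite !mulr0 addr0.
suff -> : (1 - t) * - q + t * r = x by [].
by rewrite /t; field; rewrite gt_eqF.
Qed.

Lemma both_sides S : ~ has_support S ->
  (exists a b, S a b /\ 0 < b) /\ (exists a b, S a b /\ b < 0).
Proof.
move=> nsup; split; apply: contra_notP nsup => nb.
  exists 0, (-1); split; first by rewrite oppr_eq0 oner_eq0 orbT.
  move=> a b Sab; rewrite mul0r add0r mulN1r oppr_ge0 leNgt; apply/negP => b0.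
  by apply: nb; exists a, b.
exists 0, 1; split; first by rewrite oner_eq0 orbT.
move=> a b Sab; rewrite mul0r add0r mul1r leNgt; apply/negP => b0.
by apply: nb; exists a, b.
Qed.

(* If no point of [S] lies on the open left half-axis, the quotients [- a / b] of
   the points above the axis are at most those of the points beneath it, and
   their supremum [s] gives the supporting half-plane [0 <= a + s * b]. *)
Lemma support_or_left S : convex_rel S ->
  has_support S \/ exists2 q, 0 < q & S (- q) 0.
Proof.
move=> cS; apply: contrapT => /not_orP[nsup nq].
have [[a2 [b2 [S2 b2_gt0]]] [a3 [b3 [S3 b3_lt0]]]] := both_sides nsup.
(* At the parameter [b / (b - d)] the segment crosses the horizontal axis; if the inequality failed,
   it would do so on the open left half-axis. *)
have cross a b c d : S a b -> S c d -> 0 < b -> d < 0 -> - a / b <= - c / d.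
  move=> Sab Scd b0 d0; rewrite leNgt; apply/negP => lt.
  have bd : 0 < b - d by lra.
  have t01 : 0 <= b / (b - d) <= 1.
    by rewrite divr_ge0 ?(ltW b0) ?(ltW bd) //= ler_pdivrMr //; lra.
  have := cS _ _ _ _ _ Sab Scd t01.
  have -> : (1 - b / (b - d)) * b + b / (b - d) * d = 0.
    by field; rewrite gt_eqF.
  have -> : (1 - b / (b - d)) * a + b / (b - d) * c = - ((d * a - b * c) / (b - d)).
    by field; rewrite gt_eqF.
  move=> Sx; apply: nq; exists ((d * a - b * c) / (b - d)) => //.
  apply: divr_gt0 => //.
  move: lt; rewrite ltr_pdivlMr // -mulrA mulrC -mulrA ltr_ndivrMl ?oppr_gt0 //.
  by lra.
pose E : set R := fun z => exists a b, [/\ S a b, 0 < b & z = - a / b].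
have E0 : E !=set0 by exists (- a2 / b2), a2, b2.
have Eub c d : S c d -> d < 0 -> ubound E (- c / d).
  by move=> Scd d0 _ [a [b [Sab b0 ->]]]; exact: cross.
apply: nsup; exists 1, (sup E); split; first by rewrite oner_eq0.
move=> a b Sab; rewrite mul1r; have [b0|b0|b0] := ltgtP b 0.
- have : sup E <= - a / b by apply: ge_sup => //; exact: Eub.
  by rewrite ler_ndivlMr //; lra.
- have : - a / b <= sup E.
    by apply: ub_le_sup; [exists (- a3 / b3); exact: Eub|exists a, b].
  by rewrite ler_pdivrMr //; lra.
rewrite b0 mulr0 addr0 leNgt; apply/negP => a0; apply: nq; exists (- a).
  by rewrite oppr_gt0.
by rewrite opprK -b0.
Qed.

(** A point on or above the axis lies on a segment joining (a, b) to a point [v] of the axis, and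
    [v] stays in [-q, r] when the point is close to the origin. *)
Lemma half_box S q r a b : convex_rel S -> S (- q) 0 -> S r 0 -> S a b ->
  0 < q -> 0 < r -> 0 < b ->
  exists2 e, 0 < e & forall x y, `|x| <= e -> 0 <= y <= e -> S x y.
Proof.
move=> cS Sq Sr Sab q0 r0 b0.
pose k := 1 + `|a| / b; pose m := Num.min q r.
have k0 : 0 < k by rewrite ltr_pwDl // divr_ge0 // ltW.
have m0 : 0 < m by rewrite lt_min q0 r0.
(* The bound [b / 2] keeps [t = y / b] at most 1/2; the bound [m / (2 * k)] keeps |x - t a| at most
   m / 2, hence |v| at most [m]. *)
exists (Num.min (b / 2) (m / (2 * k))).
  by rewrite lt_min divr_gt0 //= divr_gt0 // mulr_gt0.
move=> x y; rewrite !le_min => /andP[_ xm] /andP[y0 /andP[yb ym]].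
pose t := y / b.
have t0 : 0 <= t by rewrite divr_ge0 // ltW.
have t1 : t <= 1 / 2 by rewrite ler_pdivrMr //; lra.
have yE : y = t * b by rewrite /t divfK // gt_eqF.
pose v := (x - t * a) / (1 - t).
have vm : `|v| <= m.
  rewrite normrM normfV (ger0_norm (_ : 0 <= 1 - t)); last lra.
  rewrite ler_pdivrMr; last lra.
  apply: (@le_trans _ _ (m / 2)); last by rewrite ler_wpM2l ?(ltW m0) //; lra.
  apply: le_trans (ler_normB _ _) _; rewrite normrM (ger0_norm t0).
  have -> : m / 2 = m / (2 * k) + `|a| / b * (m / (2 * k)).
    by rewrite -[X in X + _]mul1r -mulrDl -/k; field; rewrite gt_eqF.
  rewrite (_ : t * `|a| = `|a| / b * y); last by rewrite /t mulrC mulrCA mulrC.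
  by rewrite lerD // ler_wpM2l // divr_ge0 // ltW.
have Sv : S v 0.
  apply: convex_rel_segment cS Sq Sr q0 r0 _.
  move: vm; rewrite ler_norml /m => /andP[v1 v2].
  have : Num.min q r <= q by rewrite ge_min lexx.
  have : Num.min q r <= r by rewrite ge_min lexx orbT.
  by rewrite /m in v1 v2 *; lra.
have t01 : 0 <= t <= 1 by lra.
have := cS _ _ _ _ _ Sv Sab t01; rewrite mulr0 add0r -yE.
suff -> : (1 - t) * v + t * a = x by [].
rewrite /v; field; apply/eqP; lra.
Qed.

(** Without a supporting line, [support_or_left] for [S] and for its point reflection gives points
    on both horizontal half-axes; [half_box] then fills a box above the axis and, after reflection
    in the axis, one below it. *)
Lemma support_or_box S : convex_rel S -> has_support S \/
  exists2 e, 0 < e & forall x y, `|x| <= e -> `|y| <= e -> S x y.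
Proof.
move=> cS; have [|nsup] := pselect (has_support S); [by left|right].
have [//|[q q0 Sq]] := support_or_left cS.
have [||[r r0]] := @support_or_left (fun a b => S (- a) (- b)).
- move=> a b c d t Sab Scd t01.
  by have := cS _ _ _ _ _ Sab Scd t01; rewrite !mulrN -!opprD.
- case=> c [s [cs0 H]]; case: nsup; exists (- c), (- s).
  split; first by rewrite !oppr_eq0.
  by move=> a b Sab; have := H (- a) (- b); rewrite !opprK !mulrN !mulNr; apply.
rewrite opprK oppr0 => Sr.
have [[a2 [b2 [S2 b2_gt0]]] [a3 [b3 [S3 b3_lt0]]]] := both_sides nsup.
have [e e0 He] := half_box cS Sq Sr S2 q0 r0 b2_gt0.
have [|||||f f0 Hf] := @half_box (fun a b => S a (- b)) q r a3 (- b3) _ _ _ _ q0 r0.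
- move=> a b c d t Sab Scd t01.
  by have := cS _ _ _ _ _ Sab Scd t01; rewrite !mulrN -!opprD.
- by rewrite oppr0.
- by rewrite oppr0.
- by rewrite opprK.
- by rewrite oppr_gt0.
exists (Num.min e f); first by rewrite lt_min e0 f0.
move=> x y; rewrite !le_min => /andP[xe xf] /andP[ye yf].
have [y0|y0] := leP 0 y.
  by apply: He => //; rewrite y0 /= -(ger0_norm y0).
rewrite -[y]opprK; apply: Hf => //.
by rewrite oppr_ge0 ltW //= -(ltr0_norm y0).
Qed.

End PlanarSeparation.

(** * The Toeplitz-Hausdorff theorem *)

Section ToeplitzHausdorff.
Variables (C : numClosedFieldType) (n : nat).
Implicit Types (A : 'M[C]_n) (x y z : 'cV[C]_n) (a b t w : C).

Lemma numerical_rangeP A w :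
  numerical_range A w <-> exists2 x, inner x x = 1 & inner (A *m x) x = w.
Proof.
by split=> [[x /vnorm_eq1 x1 <-]|[x /vnorm_eq1 x1 <-]]; exists x.
Qed.

Lemma numerical_range_scale A x w : x != 0 ->
  inner (A *m x) x = w * inner x x -> numerical_range A w.
Proof.
move=> x0 Ax; have xx : inner x x != 0.
  by apply: contraNneq x0 => /inner_eq0 ->.
have r0 : sqrtC (inner x x) != 0 by rewrite sqrtC_eq0.
have rr : (sqrtC (inner x x))^* = sqrtC (inner x x).
  by apply: geC0_conj; rewrite sqrtC_ge0 inner_ge0.
apply/numerical_rangeP; exists ((sqrtC (inner x x))^-1 *: x).
  rewrite innerZl innerZr fmorphV /= rr.
  by rewrite -[X in _ * (_ * X)]sqrtCK; field.
rewrite -scalemxAr innerZl innerZr fmorphV /= rr Ax.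
by rewrite -[X in _ * (_ * (_ * X))]sqrtCK; field.
Qed.

Lemma ex_phase (p q : C) :
  exists2 e : C, e * e^* = 1 & e * p + e^* * q \is Num.real.
Proof.
pose r := p - q^*.
have [e e1 er] : exists2 e : C, e * e^* = 1 & e * r \is Num.real.
  have [r0|r0] := eqVneq r 0; first by exists 1; rewrite ?r0 ?mulr0 ?conjC1 ?mulr1.
  have nr0 : `|r| != 0 by rewrite normr_eq0.
  exists (r^* / `|r|).
    rewrite rmorphM fmorphV /= conjCK (CrealP (normr_real r)).
    have -> : r^* / `|r| * (r / `|r|) = r * r^* / `|r| ^+ 2 by field.
    by rewrite -normCK divff // expf_neq0.
  by rewrite mulrAC [r^* * r]mulrC -normCK expr2 mulfK // normr_real.
exists e => //; apply/CrealP; move/CrealP: er; rewrite /r.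
rewrite !(rmorphM, rmorphD, rmorphN) /= !conjCK => er.
apply/eqP; rewrite -subr_eq0; apply/eqP.
move/eqP: er; rewrite -subr_eq0 => /eqP er.
by rewrite -[RHS]er; ring.
Qed.

(** By scaling, it is enough to find a nonzero combination of [x] and [y] at which the form of
    [A - w] vanishes. *)
Lemma numerical_range_convex A a b t :
  numerical_range A a -> numerical_range A b -> 0 <= t <= 1 ->
  numerical_range A ((1 - t) * a + t * b).
Proof.
move=> Wa Wb /andP[t0 t1].
have [ab|ab] := eqVneq a b; first by rewrite ab -mulrDl subrK mul1r -ab.
have [t_1|t_1] := eqVneq t 1; first by rewrite t_1 subrr mul0r add0r mul1r.
case/numerical_rangeP: Wa => x xx Ax; case/numerical_rangeP: Wb => y yy Ay.
pose w := (1 - t) * a + t * b; rewrite -/w.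
have d0 : b - a != 0 by rewrite subr_eq0 eq_sym.
pose f u v := (inner (A *m u) v - w * inner u v) / (b - a).
have fxx : f x x = - t by rewrite /f xx Ax /w; field.
have fyy : f y y = 1 - t by rewrite /f yy Ay /w; field.
(* On the real span of [e *: x] and [y], the form [f] is a real quadratic form,
   of value [- t <= 0] at [e *: x] and [1 - t > 0] at [y]: it has a zero. *)
have [e e1 bR] := ex_phase (f x y) (f y x).
set B := e * f x y + e^* * f y x in bR.
have g0 : 0 < 1 - t by rewrite subr_gt0 lt_neqAle t_1 t1.
have g0' := lt0r_neq0 g0.
have t_real : t^* = t by apply: geC0_conj.
(* [D] is the discriminant of the quadratic equation [vE] in [v]; it is nonnegative because
   [- t <= 0 < 1 - t]. *)
pose D := B ^+ 2 + 4 * (1 - t) * t.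
have D0 : 0 <= D.
  rewrite addr_ge0 ?real_exprn_even_ge0 // mulr_ge0 // mulr_ge0 ?ltW //.
pose v := (sqrtC D - B) / (2 * (1 - t)).
have vR : v^* = v.
  apply/CrealP; rewrite realM // ?realV ?realB // ?ger0_real ?sqrtC_ge0 //.
  by rewrite mulr_ge0 // ltW.
have vE : - t + v * B + v ^+ 2 * (1 - t) = 0.
  have DE : sqrtC D ^+ 2 = B ^+ 2 + 4 * (1 - t) * t by rewrite sqrtCK.
  have -> : - t + v * B + v ^+ 2 * (1 - t) =
    (sqrtC D ^+ 2 - (B ^+ 2 + 4 * (1 - t) * t)) / (4 * (1 - t)).
    by rewrite /v; field.
  by rewrite DE subrr mul0r.
have fE (u1 u2 : C) : inner (A *m (u1 *: x + u2 *: y)) (u1 *: x + u2 *: y)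
   - w * inner (u1 *: x + u2 *: y) (u1 *: x + u2 *: y) =
   (b - a) * (u1 * u1^* * f x x + u1 * u2^* * f x y + u2 * u1^* * f y x
     + u2 * u2^* * f y y).
  rewrite mulmxDr -!scalemxAr !(innerDl, innerDr, innerZl, innerZr) /f.
  by field.
apply: (@numerical_range_scale _ (e *: x + v *: y)).
  (* If the combination were zero, [e *: x] would equal [- v *: y] with [v ^+ 2 = 1], and [f] would
     be both [- t] and [1 - t] there. *)
  apply/negP => /eqP z0.
  have ex : e *: x = - v *: y by apply/eqP; rewrite -subr_eq0 scaleNr opprK z0.
  have v1 : v ^+ 2 = 1.
    have : inner (e *: x) (e *: x) = 1 by rewrite innerZl innerZr xx mulr1.
    by rewrite ex innerZl innerZr yy rmorphN /= vR mulr1 mulrNN.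
  have := fE e 0; have := fE 0 (- v).
  rewrite !scale0r !add0r !addr0 ex => -> /eqP.
  rewrite rmorphN /= vR conjC0 !mulr0 !mul0r !add0r !addr0.
  rewrite (inj_eq (mulfI d0)) e1 fxx fyy mulrNN -expr2 v1 !mul1r.
  by rewrite -subr_eq0 [_ - _](_ : _ = 1) ?oner_eq0 //; ring.
apply/eqP; rewrite -subr_eq0 fE fxx fyy vR e1.
suff -> : 1 * - t + e * v * f x y + v * e^* * f y x + v * v * (1 - t) = 0 by rewrite mulr0.
by rewrite -[RHS]vE /B; ring.
Qed.

End ToeplitzHausdorff.

(** * Supporting lines and extreme eigenvectors *)

Section Direction.
Variables (C : numClosedFieldType) (n : nat).
Implicit Types (A K : 'M[C]_n) (x y : 'cV[C]_n) (c s w : C).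

Definition direction A c s : 'M[C]_n := c *: hermitian_re A + s *: hermitian_im A.

Lemma inner_direction A c s x y : inner (direction A c s *m x) y =
  c * inner (hermitian_re A *m x) y + s * inner (hermitian_im A *m x) y.
Proof. by rewrite mulmxDl -!scalemxAl innerDl !innerZl. Qed.

Lemma inner_direction_diag A c s x : inner (direction A c s *m x) x =
  c * 'Re (inner (A *m x) x) + s * 'Im (inner (A *m x) x).
Proof. by rewrite inner_direction inner_hermitian_re_diag inner_hermitian_im_diag. Qed.

Lemma inner_direction_conj A c s x y : c \is Num.real -> s \is Num.real ->
  (inner (direction A c s *m x) y)^* = inner (direction A c s *m y) x.
Proof.
move=> /CrealP cR /CrealP sR; rewrite !inner_direction rmorphD !rmorphM /= cR sR.
by rewrite inner_hermitian_re_conj inner_hermitian_im_conj.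
Qed.

(** The hypotheses form an invertible linear system in the values of the two Hermitian parts, which
    combine to that of [A]. *)
Lemma independent_directions_inner_eq0 A c s c' s' x y : c * s' - s * c' != 0 ->
  inner (direction A c s *m x) y = 0 -> inner (direction A c' s' *m x) y = 0 ->
  inner (A *m x) y = 0.
Proof.
rewrite !inner_direction (inner_decomp A).
set h := inner (hermitian_re A *m x) y; set k := inner (hermitian_im A *m x) y.
move=> d0 e1 e2.
have h0 : h = 0.
  apply: (mulfI d0); rewrite mulr0.
  transitivity (s' * (c * h + s * k) - s * (c' * h + s' * k)); first by ring.
  by rewrite e1 e2 !mulr0 subrr.
have k0 : k = 0.
  apply: (mulfI d0); rewrite mulr0.
  transitivity (c * (c' * h + s' * k) - c' * (c * h + s * k)); first by ring.
  by rewrite e1 e2 !mulr0 subrr.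
by rewrite h0 k0 mulr0 addr0.
Qed.

(** Isolated as a property because its proof uses suprema of real numbers, while the other arguments
    run over an abstract [C]. *)
Definition boundary_supported A := forall w, boundary (numerical_range A) w ->
  exists c s, [/\ c \is Num.real, s \is Num.real, (c != 0) || (s != 0) &
    forall z, numerical_range A z -> c * 'Re w + s * 'Im w <= c * 'Re z + s * 'Im z].

(** Moving [x] slightly against [K *m x] gives the form a negative first-order term, which
    contradicts positivity unless [K *m x = 0]. *)
Lemma psd_isotropic_kernel K x :
  (forall u v, (inner (K *m u) v)^* = inner (K *m v) u) ->
  (forall y, 0 <= inner (K *m y) y) -> inner (K *m x) x = 0 -> K *m x = 0.
Proof.
move=> hK pK Kx; apply: inner_eq0; apply/eqP; apply: contraT => N0.
set N := inner (K *m x) (K *m x) in N0.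
have {N0}Np : 0 < N by rewrite lt_neqAle eq_sym N0 inner_ge0.
set y := K *m x in N Np; pose k := inner (K *m y) y.
have k0 : 0 <= k by exact: pK.
have k1 : 0 < k + 1 by rewrite ltr_wpDl.
(* This step size gives [e * k < N], so the linear term [2 * e * N] exceeds the quadratic term
   [e ^+ 2 * k]. *)
pose e := N / (k + 1).
have e0 : 0 < e by rewrite divr_gt0.
have eR : e^* = e by apply: geC0_conj; exact: ltW.
have := pK (x + - e *: y).
rewrite mulmxDr -scalemxAr !(innerDl, innerDr, innerZl, innerZr) Kx -/y -/N -/k.
have -> : inner (K *m y) x = N by rewrite -hK -/y /N inner_conj.
rewrite rmorphN /= eR => H.
have : e * (e * k - 2 * N) < 0.
  rewrite pmulr_rlt0 // subr_lt0.
  have -> : e * k = N * (k / (k + 1)) by rewrite /e; field; exact: lt0r_neq0.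
  rewrite mulrC ltr_pM2r // ltr_pdivrMr // mulrDr mulr1 mulr_natl mulr2n.
  by rewrite -addrA ltrDl ltr_wpDl // ltr0n.
move=> neg; move: H.
suff -> : 0 + - e * N + (- e * N + - e * (- e * k)) = e * (e * k - 2 * N) by rewrite lt_geF.
by ring.
Qed.

Lemma support_form_ge A c s l y : c \is Num.real -> s \is Num.real ->
  (forall z, numerical_range A z -> l <= c * 'Re z + s * 'Im z) ->
  l * inner y y <= inner (direction A c s *m y) y.
Proof.
move=> cR sR supp; have [->|y0] := eqVneq y 0.
  by rewrite mulmx0 innerE big1 ?mulr0 // => k _; rewrite mxE mul0r.
have yy : 0 < inner y y.
  rewrite lt_neqAle inner_ge0 andbT eq_sym.
  by apply: contraNneq y0 => /inner_eq0 ->.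
have yy0 := lt0r_neq0 yy; have yyR := gtr0_real yy.
have := supp (inner (A *m y) y / inner y y).
rewrite inner_direction_diag ReMr ?realV // ImMr ?realV // !mulrA -mulrDl.
rewrite ler_pdivlMr //; apply.
by apply: (numerical_range_scale y0); rewrite divfK.
Qed.

(** Subtracting the minimum [l] leaves a positive semidefinite matrix that is isotropic at [x], so
    [psd_isotropic_kernel] applies. *)
Lemma support_eigenvector A c s x : c \is Num.real -> s \is Num.real ->
  inner x x = 1 ->
  (forall z, numerical_range A z ->
    inner (direction A c s *m x) x <= c * 'Re z + s * 'Im z) ->
  direction A c s *m x = inner (direction A c s *m x) x *: x.
Proof.
move=> cR sR xx supp; set l := inner _ x in supp *.
apply/eqP; rewrite -subr_eq0; apply/eqP; rewrite -mul_scalar_mx -mulmxBl.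
have lR : l^* = l by rewrite inner_direction_conj.
apply: psd_isotropic_kernel => [u v|y|].
- rewrite !mulmxBl !innerDl !innerNl !mul_scalar_mx !innerZl rmorphB rmorphM /=.
  by rewrite lR inner_direction_conj // inner_conj.
- rewrite mulmxBl innerDl innerNl mul_scalar_mx innerZl subr_ge0.
  exact: support_form_ge.
by rewrite mulmxBl innerDl innerNl mul_scalar_mx innerZl xx mulr1 subrr.
Qed.

Lemma interior_normP (S : set C) z :
  interior S z <-> exists2 e : C, 0 < e & forall u, `|z - u| < e -> S u.
Proof.
rewrite /interior; split=> [/nbhs_ballP[e e0 He]|[e e0 He]].
  by exists e => // u zu; apply: He.
by apply/nbhs_ballP; exists e => // u; apply: He.
Qed.

(** Were [w] interior, a small move along -(c + i s) would stay in the numerical range and lower the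
    functional by a positive multiple of c^2 + s^2. *)
Lemma boundary_of_support A c s w : c \is Num.real -> s \is Num.real ->
  (c != 0) || (s != 0) -> numerical_range A w ->
  (forall z, numerical_range A z -> c * 'Re w + s * 'Im w <= c * 'Re z + s * 'Im z) ->
  boundary (numerical_range A) w.
Proof.
move=> cR sR cs0 Ww supp; split; first exact: subset_closure.
move=> /interior_normP[e e0 He].
pose v := c + 'i * s.
have v0 : 0 < `|v|.
  rewrite normr_gt0; apply: contraTneq cs0 => v0.
  have := congr1 (@Re C) v0; have := congr1 (@Im C) v0.
  by rewrite Re_rect // Im_rect // !raddf0 => -> ->; rewrite eqxx.
pose k := e / 2 / `|v|.
have k0 : 0 < k by rewrite !divr_gt0.
have kR := gtr0_real k0.
have := supp (w - k * v); rewrite !raddfB /= ReMl // ImMl // Re_rect // Im_rect //.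
have H : numerical_range A (w - k * v).
  apply: He; rewrite opprB addrC subrK normrM (gtr0_norm k0) divfK ?gt_eqF //.
  by rewrite ltr_pdivrMr // ltr_pMr // ltr1n.
move=> /(_ H); rewrite !mulrBr addrACA -opprD lerDl.
rewrite oppr_ge0 !(mulrCA _ k) -mulrDr pmulr_rle0 // -!expr2 => le0.
have : c ^+ 2 + s ^+ 2 == 0 by rewrite eq_le le0 addr_ge0 ?real_exprn_even_ge0.
rewrite paddr_eq0 ?real_exprn_even_ge0 // !expf_eq0 /= => /andP[/eqP c0 /eqP s0].
by move: cs0; rewrite c0 s0 eqxx.
Qed.

End Direction.

(** * Existence of supporting lines over the complex numbers *)

Section SupportingLine.
Variables (R : realType) (n : nat).
Local Open Scope complex_scope.

(** With [w] translated to the origin, a box inside the numerical range would contain a disc and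
    make [w] interior; so [support_or_box] must yield a supporting line. *)
Lemma boundary_support (A : 'M[R[i]]_n) : boundary_supported A.
Proof.
move=> w [_ nint]; pose S (a b : R) := numerical_range A (w + (a +i* b)).
have [||[e e0 He]] := @support_or_box R S.
- move=> a b c d t Sab Scd /andP[t0 t1].
  have t01 : 0 <= t%:C <= 1 by rewrite !lecR t0 t1.
  have := numerical_range_convex Sab Scd t01; rewrite /S.
  congr (numerical_range A _); case: (w) => w1 w2.
  by apply/eqP; rewrite eq_complex /=; apply/andP; split; apply/eqP; ring.
- case=> c [s [cs0 supp]]; exists c%:C, s%:C; split.
  + by rewrite complex_real.
  + by rewrite complex_real.
  + by rewrite !(inj_eq (@complexI R)).
  move=> z Wz; rewrite -!complexRe -!complexIm -!rmorphM -!rmorphD lecR.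
  have := supp (complex.Re (z - w)) (complex.Im (z - w)).
  rewrite /S !raddfB /= => H; rewrite -subr_ge0.
  have -> : c * complex.Re z + s * complex.Im z - (c * complex.Re w + s * complex.Im w)
    = c * (complex.Re z - complex.Re w) + s * (complex.Im z - complex.Im w) by ring.
  apply: H; suff -> : w + ((complex.Re z - complex.Re w) +i* (complex.Im z - complex.Im w)) = z.
    by [].
  by case: (z) (w) => [? ?] [? ?] /=; apply/eqP; rewrite eq_complex /= !subrKC !eqxx.
exfalso; apply: nint; apply/interior_normP; exists e%:C; first by rewrite ltcR.
move=> y; rewrite distrC => wy.
have Se : S (complex.Re (y - w)) (complex.Im (y - w)).
  move: wy; rewrite normc_def ltcR => /ltW wy; apply: He; apply: le_trans wy.
    by rewrite -sqrtr_sqr ler_wsqrtr // lerDl sqr_ge0.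
  by rewrite -sqrtr_sqr ler_wsqrtr // lerDr sqr_ge0.
suff -> : y = w + (complex.Re (y - w) +i* complex.Im (y - w)) by [].
by case: (y) (w) => [? ?] [? ?] /=; apply/eqP; rewrite eq_complex /= !subrKC !eqxx.
Qed.

End SupportingLine.

(** * The two sides of the equivalence *)

Section Spectral.
Variables (C : numClosedFieldType) (n : nat).
Implicit Types (A V H : 'M[C]_n) (D : 'rV[C]_n) (P : 'rV[C]_3) (x y : 'cV[C]_n) (c s : C).

Lemma mxdot3 (P : 'rV[C]_3) (l : 'cV[C]_3) :
  (P *m l = 0) <-> (P 0 0 * l 0 0 + P 0 1 * l 1 0 + P 0 2 * l 2 0 = 0).
Proof.
have E : (P *m l) 0 0 = P 0 0 * l 0 0 + P 0 1 * l 1 0 + P 0 2 * l 2 0.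
  rewrite mxE !big_ord_recl big_ord0 addr0 addrA.
  by congr (P 0 _ * l _ 0 + P 0 _ * l _ 0 + P 0 _ * l _ 0); apply: val_inj.
split=> [Pl|Pl]; first by rewrite -E Pl mxE.
by apply/matrixP => i j; rewrite !ord1 E Pl mxE.
Qed.

Lemma row3P (P Q : 'rV[C]_3) :
  P 0 0 = Q 0 0 -> P 0 1 = Q 0 1 -> P 0 2 = Q 0 2 -> P = Q.
Proof.
move=> e0 e1 e2; apply/rowP => -[[|[|[|//]]] h].
- by rewrite (_ : Ordinal h = 0) //; apply: val_inj.
- by rewrite (_ : Ordinal h = 1) //; apply: val_inj.
- by rewrite (_ : Ordinal h = 2) //; apply: val_inj.
Qed.

Lemma parallel_scale (c s c' s' : C) : (c != 0) || (s != 0) ->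
  c * s' - s * c' = 0 -> exists2 m, c' = m * c & s' = m * s.
Proof.
move=> cs0 /eqP; rewrite subr_eq0 => /eqP e; case/orP: cs0 => [c0|s0].
  by exists (c' / c); [rewrite divfK|rewrite mulrAC -[c' * s]mulrC -e mulrAC divff ?mul1r].
by exists (s' / s); [rewrite mulrAC -[s' * c]mulrC e mulrAC divff ?mul1r|rewrite divfK].
Qed.

Lemma parallel_trans (c s c1 s1 c2 s2 : C) : (c1 != 0) || (s1 != 0) ->
  c * s1 - s * c1 = 0 -> c1 * s2 - s1 * c2 = 0 -> c * s2 - s * c2 = 0.
Proof.
move=> n1 e1 /(parallel_scale n1)[m -> ->].
by rewrite !(mulrCA _ m) -mulrBr e1 mulr0.
Qed.

Lemma unitary_mulVt V : V \is unitarymx -> V^t* *m V = 1%:M.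
Proof. by rewrite -trmxC_unitary => /unitarymxP; rewrite trmxCK. Qed.

Lemma unitary_diagE H V D : V \is unitarymx -> V *m H *m V^t* = diag_mx D ->
  H = V^t* *m diag_mx D *m V.
Proof.
move=> uV <-; rewrite !mulmxA unitary_mulVt // mul1mx -mulmxA.
by rewrite unitary_mulVt // mulmx1.
Qed.

Lemma direction_trmxC A c s : c \is Num.real -> s \is Num.real ->
  (direction A c s)^t* = direction A c s.
Proof.
have half : (2^-1 : C)^* = 2^-1 by rewrite fmorphV /= conjC_nat.
have halfi : ((2 * 'i)^-1 : C)^* = - (2 * 'i)^-1.
  by rewrite fmorphV rmorphM /= conjC_nat conjCi mulrN invrN.
move: half halfi; rewrite /direction /hermitian_re /hermitian_im.
move: (2^-1) ((2 * 'i)^-1) => h hi hE hiE /CrealP cR /CrealP sR.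
apply/matrixP => i j; rewrite !mxE.
rewrite !(rmorphD, rmorphM, rmorphN) /= !conjCK cR sR hE hiE.
by ring.
Qed.

Lemma direction_spectral A c s : c \is Num.real -> s \is Num.real ->
  exists V D, V \is unitarymx /\ V *m direction A c s *m V^t* = diag_mx D.
Proof.
move=> cR sR; set H := direction A c s.
have /orthomx_spectralP HE : H \is normalmx.
  by apply/normalmxP; rewrite direction_trmxC.
exists (spectralmx H), (spectral_diag H); split; first exact: spectral_unitarymx.
have uV := spectral_unitarymx H.
rewrite {2}HE invmx_unitary // !mulmxA (unitarymxP uV) mul1mx.
by rewrite -mulmxA (unitarymxP uV) mulmx1.
Qed.

(** The factor [m] serves points whose coordinates are a complex multiple of a real direction. *)
Lemma pencil_direction A V D P c s m : V \is unitarymx ->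
  V *m direction A c s *m V^t* = diag_mx D -> P 0 0 = m * c -> P 0 1 = m * s ->
  V *m pencil A P *m V^t* = diag_mx (m *: D + const_mx (P 0 2)).
Proof.
move=> uV VHV P0 P1; rewrite /pencil P0 P1 -!scalerA -scalerDr.
rewrite mulmxDr mulmxDl -scalemxAr -scalemxAl VHV mul_mx_scalar -scalemxAl.
by rewrite (unitarymxP uV) !linearD !linearZ /= diag_const_mx scalemx1.
Qed.

Lemma ord_base_curve_direction A V D P c s m : V \is unitarymx ->
  V *m direction A c s *m V^t* = diag_mx D -> P 0 0 = m * c -> P 0 1 = m * s ->
  ord_base_curve A P = #|[pred i | m * D 0 i + P 0 2 == 0]|.
Proof.
move=> uV VHV P0 P1; rewrite (ord_base_curveE uV (pencil_direction uV VHV P0 P1)).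
by apply: eq_card => i; rewrite !inE !mxE.
Qed.

Lemma meval_base_poly_direction A V D P c s m : V \is unitarymx ->
  V *m direction A c s *m V^t* = diag_mx D -> P 0 0 = m * c -> P 0 1 = m * s ->
  meval (P 0) (base_poly A) = \prod_i (m * D 0 i + P 0 2).
Proof.
move=> uV VHV P0 P1; rewrite meval_base_poly.
have -> : \det (pencil A P) = \det (V *m pencil A P *m V^t* ).
  rewrite !det_mulmx mulrAC -det_mulmx (unitarymxP uV) det1 mul1r //.
rewrite (pencil_direction uV VHV P0 P1) det_diag.
by apply: eq_bigr => i _; rewrite !mxE.
Qed.

Lemma unitarily_reducible_of_pred A V (p : pred 'I_n) i0 j0 : p i0 -> ~~ p j0 ->
  V \is unitarymx ->
  (forall i j, p i != p j -> (V *m A *m V^t* ) i j = 0) -> unitarily_reducible A.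
Proof.
move=> pi0 pj0 uV VAV; pose g j : 'I_2 := if p j then 0 else 1.
apply: (@unitarily_reducible_of_partition _ _ _ V 2 g) => //.
  move=> i; have [->|i1] := eqVneq i 0; first by exists i0; rewrite /g pi0.
  exists j0; rewrite /g (negPf pj0); apply: val_inj.
  by case: i i1 => [[|[|]]].
by move=> i j gij; apply: VAV; apply: contraNneq gij => pij; rewrite /g pij.
Qed.

(* The quarter turn of a scalar direction is Hermitian, hence diagonalizable, and
   both together diagonalize [A]. *)
Lemma unitarily_reducible_scalar_direction A c s t : (2 <= n)%N ->
  c \is Num.real -> s \is Num.real -> (c != 0) || (s != 0) ->
  direction A c s = t%:M -> unitarily_reducible A.
Proof.
move=> n2 cR sR cs0 Ht.
have sNR : - s \is Num.real by rewrite rpredN.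
have [V [D [uV VKV]]] := direction_spectral A sNR cR.
pose i0 : 'I_n := Ordinal (ltnW n2); pose i1 : 'I_n := Ordinal n2.
apply: (@unitarily_reducible_of_pred A V (pred1 i0) i0 i1) => //=.
move=> i j pij; rewrite -inner_row.
have ij : i != j by apply: contraNneq pij => ->.
apply: (@independent_directions_inner_eq0 _ _ A c s (- s) c).
- rewrite mulrN opprK -!expr2 paddr_eq0 ?real_exprn_even_ge0 //.
  by rewrite !expf_eq0 /= negb_and.
- rewrite inner_row Ht mul_mx_scalar -scalemxAl (unitarymxP uV) !mxE.
  by rewrite (negPf ij) mulr0.
by rewrite inner_row VKV mxE (negPf ij).
Qed.

(** At a unit vector this is a weighted mean of the eigenvalues, which makes extreme eigenvalues
    extreme values of the form. *)
Lemma inner_spectral H V D y : V \is unitarymx -> V *m H *m V^t* = diag_mx D ->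
  inner (H *m y) y = \sum_k D 0 k * `|(V *m y) k 0| ^+ 2.
Proof.
move=> uV VHV.
rewrite (unitary_diagE uV VHV).
rewrite -!mulmxA inner_trmxC inner_conj innerE.
by apply: eq_bigr => k _; rewrite mul_diag_mx mxE normCK mulrA.
Qed.

Lemma inner_unitary V y : V \is unitarymx ->
  inner y y = \sum_k `|(V *m y) k 0| ^+ 2.
Proof.
move=> uV; rewrite -[in LHS](mul1mx y) -{1}(mul1mx y).
rewrite -{1}(unitary_mulVt uV) mul1mx -mulmxA inner_trmxC inner_conj innerE.
by apply: eq_bigr => k _; rewrite normCK.
Qed.

End Spectral.

Section Proposition.
Variables (C : numClosedFieldType) (n : nat).
Implicit Types (A V : 'M[C]_n) (D : 'rV[C]_n) (c s : C) (P Q : 'rV[C]_3).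

Lemma gau_wu_number_eq_size A :
  gau_wu_number A = n <-> exists x : 'I_n -> 'cV[C]_n, boundary_family A x.
Proof.
rewrite /gau_wu_number; case: ex_maxnP => k /asboolP hk kmax.
split=> [kn|fam]; first by move: hk; rewrite kn.
apply/eqP; rewrite eqn_leq kmax; last exact/asboolP.
by rewrite andbT (@boundary_family_leq _ _ A) //; apply/asboolP.
Qed.

(** Each [x j] is an eigenvector of its own supporting direction; irreducibility makes all these
    directions proportional, so the family diagonalizes a single one. *)
Lemma boundary_family_direction A (x : 'I_n -> 'cV[C]_n) : (2 <= n)%N ->
  unitarily_irreducible A -> boundary_supported A -> boundary_family A x ->
  exists c s : C, exists V (D : 'rV[C]_n), [/\ c \is Num.real /\ s \is Num.real,
    (c != 0) || (s != 0), V \is unitarymx,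
    V *m direction A c s *m V^t* = diag_mx D &
    forall j, (forall k, D 0 j <= D 0 k) \/ (forall k, D 0 k <= D 0 j)].
Proof.
move=> n_ge2 A_irr A_supported [ox bx].
have /choice[cs csP] j : exists p : C * C, [/\ p.1 \is Num.real, p.2 \is Num.real,
    (p.1 != 0) || (p.2 != 0) & forall z, numerical_range A z ->
      p.1 * 'Re (inner (A *m x j) (x j)) + p.2 * 'Im (inner (A *m x j) (x j))
        <= p.1 * 'Re z + p.2 * 'Im z].
  by have [c [s ?]] := A_supported _ (bx j); exists (c, s).
pose H j := direction A (cs j).1 (cs j).2.
have Hx j : exists l, H j *m x j = l *: x j.
  have [cR sR _ supp] := csP j.
  exists (inner (H j *m x j) (x j)); apply: support_eigenvector => //.
    by rewrite ox eqxx.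
  by move=> z Wz; rewrite inner_direction_diag; exact: supp.
have Hxx j k : j != k -> inner (H j *m x j) (x k) = 0.
  by move=> jk; have [l ->] := Hx j; rewrite innerZl ox (negPf jk) mulr0.
have Hxx' j k : j != k -> inner (H j *m x k) (x j) = 0.
  move=> jk; have [cR sR _ _] := csP j.
  by rewrite -inner_direction_conj // Hxx // conjC0.
(* Conjugation makes [(row j V)^t*] equal to [x j], as [inner_row] requires. *)
pose V : 'M[C]_n := \matrix_(j, k) (x j k 0)^*.
have Vx j : (row j V)^t* = x j.
  by apply/matrixP => k l; rewrite ord1 !mxE conjCK.
have uV : V \is unitarymx.
  apply/unitarymxP/matrixP => i j; rewrite -[V in V *m _]mulmx1 -inner_row !Vx mul1mx ox mxE.
  by rewrite eq_sym.
pose i0 : 'I_n := Ordinal (ltnW n_ge2).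
pose det j k := (cs j).1 * (cs k).2 - (cs j).2 * (cs k).1.
(* If the supporting lines at two vectors of the family are not parallel, the
   corresponding off-diagonal entries of [A] vanish; so the vectors whose line is
   parallel to the first one span a reducing subspace. *)
have parallel j : det i0 j = 0.
  apply: contra_notP A_irr => /eqP pj.
  apply: (@unitarily_reducible_of_pred _ _ A V (fun k => det i0 k == 0) i0 j) => //.
    by rewrite /det mulrC subrr.
  move=> j1 k1 pjk; rewrite -inner_row !Vx.
  have jk : j1 != k1 by apply: contraNneq pjk => ->.
  apply: (@independent_directions_inner_eq0 _ _ A (cs j1).1 (cs j1).2 (cs k1).1 (cs k1).2).
  (* Parallelism is transitive for nonzero directions, so vectors separated by the predicate cannot
     have parallel lines. *)
  - apply: contraNneq pjk => d0; apply/eqP.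
    have [_ _ n1 _] := csP j1; have [_ _ n2 _] := csP k1.
    have d0' : (cs k1).1 * (cs j1).2 - (cs k1).2 * (cs j1).1 = 0.
      by rewrite -[RHS]oppr0 -d0; ring.
    by apply/eqP/eqP => e; [exact: parallel_trans n1 e d0|exact: parallel_trans n2 e d0'].
  - exact: Hxx'.
  - by apply: Hxx; rewrite eq_sym.
have [cR sR ne0 _] := csP i0.
set c := (cs i0).1 in cR ne0; set s := (cs i0).2 in sR ne0.
pose w j := inner (A *m x j) (x j).
pose m j := c * 'Re (w j) + s * 'Im (w j).
have scal j : exists e : C, [/\ e \is Num.real, e != 0, (cs j).1 = e * c & (cs j).2 = e * s].
  have [e e1 e2] := parallel_scale ne0 (parallel j).
  have [cjR sjR nj _] := csP j; exists e; split=> //.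
    have [c0|c0] := eqVneq c 0.
      have s0 : s != 0 by move: ne0; rewrite c0 eqxx.
      by rewrite -[e](mulfK s0) -e2 rpred_div.
    by rewrite -[e](mulfK c0) -e1 rpred_div.
  by apply: contraTneq nj => e0; rewrite e1 e2 e0 !mul0r eqxx.
exists c, s, V, (\row_j m j); split=> //.
  apply/matrixP => i j; rewrite -inner_row !Vx !mxE.
  have [->|ij] := eqVneq i j; first by rewrite inner_direction_diag.
  have [e [_ e0 e1 e2]] := scal i.
  have := Hxx' i j ij; rewrite /H e1 e2 !inner_direction -!mulrA -mulrDr => /eqP.
  by rewrite mulf_eq0 (negPf e0) => /eqP.
move=> j; have [e [eR e0 e1 e2]] := scal j; have [_ _ _ supp] := csP j.
have wW k : numerical_range A (w k).
  by apply/numerical_rangeP; exists (x k) => //; rewrite ox eqxx.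
have mm k : e * m j <= e * m k.
  have := supp _ (wW k); rewrite e1 e2 -/(w j) -!mulrA -!mulrDr.
  exact.
(* The direction of [x j] is [e] times (c, s); a negative [e] turns its minimum into a maximum for
   (c, s). *)
have [ep|en] := real_ltP (real0 C) eR.
  by left=> k; rewrite !mxE -(ler_pM2l ep).
right=> k; rewrite !mxE.
have en' : e < 0 by rewrite lt_neqAle e0.
by rewrite -(ler_nM2l en').
Qed.

(** All least values coincide by antisymmetry, and so do all greatest ones; since [D i] and [D j]
    differ, one is the least and the other the greatest. *)
Lemma extreme_values (I : finType) (D : I -> C) (i j : I) :
  (forall k, (forall l, D k <= D l) \/ (forall l, D l <= D k)) ->
  D i != D j -> forall k, D k = D i \/ D k = D j.
Proof.
move=> ext ij k; have le_eq u v : (forall l, D u <= D l) -> (forall l, D v <= D l) -> D u = D v.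
  by move=> hu hv; apply: le_anti; rewrite hu hv.
have ge_eq u v : (forall l, D l <= D u) -> (forall l, D l <= D v) -> D u = D v.
  by move=> hu hv; apply: le_anti; rewrite hu hv.
have nij : D i <> D j by apply/eqP.
case: (ext k) (ext i) (ext j) => hk [hi|hi] [hj|hj];
  by [left; apply: le_eq|left; apply: ge_eq|right; apply: le_eq|right; apply: ge_eq
     |case: nij; apply: le_eq|case: nij; apply: ge_eq].
Qed.

Definition hpoint (a b t : C) : 'rV[C]_3 := \row_k nth 0 [:: a; b; t] k.

Lemma base_points_of_boundary_family A (x : 'I_n -> 'cV[C]_n) : (2 <= n)%N ->
  unitarily_irreducible A -> boundary_supported A -> boundary_family A x ->
  exists P Q : 'rV[C]_3,
    [/\ on_base_curve A P /\ on_base_curve A Q,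
        real_point P /\ real_point Q,
        ~ same_point P Q,
        collinear origin P Q &
        (ord_base_curve A P + ord_base_curve A Q)%N = n].
Proof.
move=> n_ge2 A_irr A_supported.
move=> /(boundary_family_direction n_ge2 A_irr A_supported)[c [s [V [D [[cR sR] cs0 uV VHV ext]]]]].
pose i0 : 'I_n := Ordinal (ltnW n_ge2).
(* A single eigenvalue would make the direction a scalar matrix, and [A] reducible. *)
have [j1 ij1] : exists j, D 0 i0 != D 0 j.
  apply: contra_notP A_irr => allD.
  apply: (unitarily_reducible_scalar_direction n_ge2 cR sR cs0 (t := D 0 i0)).
  rewrite (unitary_diagE uV VHV).
  have -> : D = const_mx (D 0 i0).
    apply/rowP => j; rewrite mxE; apply/eqP; rewrite eq_sym.
    by apply: contra_notT allD => ?; exists j.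
  by rewrite diag_const_mx mul_mx_scalar -scalemxAl unitary_mulVt // scalemx1 mxE.
have two := extreme_values ext ij1.
have DR j : D 0 j \is Num.real.
  have -> : D 0 j = (V *m direction A c s *m V^t* ) j j by rewrite VHV mxE eqxx.
  rewrite -inner_row; apply/CrealP; exact: inner_direction_conj.
pose pt j := hpoint c s (- D 0 j).
have pt0 j : pt j 0 0 = 1 * c by rewrite mxE mul1r.
have pt1 j : pt j 0 1 = 1 * s by rewrite mxE mul1r.
have pt2 j : pt j 0 2 = - D 0 j by rewrite mxE.
have onC j : on_base_curve A (pt j).
  split.
    apply/eqP => pj0; move: cs0; move: (pt0 j) (pt1 j); rewrite pj0 !mxE !mul1r.
    by move=> <- <-; rewrite eqxx.
  rewrite (meval_base_poly_direction uV VHV (pt0 j) (pt1 j)).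
  by apply/eqP/prodf_eq0; exists j => //; rewrite pt2 mul1r subrr.
have real j : real_point (pt j).
  exists 1; first exact: oner_neq0.
  rewrite scale1r; apply/mxOverP => i k; rewrite mxE.
  by case: k => [[|[|[|//]]] ?] //=; rewrite rpredN.
have ordE j : ord_base_curve A (pt j) = #|[pred i | D 0 i == D 0 j]|.
  rewrite (ord_base_curve_direction uV VHV (pt0 j) (pt1 j)).
  by apply: eq_card => i; rewrite !inE pt2 mul1r subr_eq0.
exists (pt i0), (pt j1); split=> //.
- move=> [e _ E].
  have Ei k : pt j1 0 k = e * pt i0 0 k by rewrite E mxE.
  have e1 : e = 1.
    have := Ei 0; have := Ei 1; rewrite !pt0 !pt1 !mul1r => es ec.
    case/orP: cs0 => [c0|s0].
      by apply: (mulIf c0); rewrite mul1r -ec.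
    by apply: (mulIf s0); rewrite mul1r -es.
  have := Ei 2; rewrite !pt2 e1 mul1r => /oppr_inj Dij.
  by rewrite Dij eqxx in ij1.
(* The line s x - c y = 0 passes through the origin and every point (c : s : t). *)
- exists (\col_k nth 0 [:: s; - c; 0] k).
    apply/eqP => l0; move: cs0.
    have := congr1 (fun l : 'cV[C]_3 => l 0 0) l0.
    have := congr1 (fun l : 'cV[C]_3 => l 1 0) l0.
    by rewrite !mxE /= => /eqP; rewrite oppr_eq0 => /eqP -> ->; rewrite eqxx.
  have orth j : pt j *m (\col_k nth 0 [:: s; - c; 0] k) = 0.
    by apply/mxdot3; rewrite pt0 pt1 pt2 !mxE /=; ring.
  split=> //; apply/mxdot3; rewrite !mxE /=; ring.
rewrite !ordE -[RHS]card_ord -(cardC [pred i | D 0 i == D 0 i0]); congr (_ + _)%N.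
apply: eq_card => i; rewrite !inE.
by have [-> | ->] := two i; rewrite eqxx ?(negPf ij1) // eq_sym ?ij1 // (negPf ij1).
Qed.

(** The functional equals [D 0 j] at the [j]-th vector and a mean of all the eigenvalues at any unit
    vector, so an extreme [D 0 j] gives a supporting line; a greatest one is treated with the
    opposite direction. *)
Lemma boundary_family_of_spectral A V D c s :
  c \is Num.real -> s \is Num.real -> (c != 0) || (s != 0) -> V \is unitarymx ->
  V *m direction A c s *m V^t* = diag_mx D ->
  (forall j, (forall k, D 0 j <= D 0 k) \/ (forall k, D 0 k <= D 0 j)) ->
  boundary_family A (fun j => (row j V)^t* ).
Proof.
move=> cR sR cs0 uV VHV ext; have ox : Defs.orthonormal (fun j => (row j V)^t* ).
  move=> i j; rewrite -[X in inner X _](mul1mx ((row i V)^t* )) inner_row mulmx1.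
  by rewrite (unitarymxP uV) mxE eq_sym.
split=> // j; set x := _^t*.
have xx : inner x x = 1 by rewrite ox eqxx.
have wW : numerical_range A (inner (A *m x) x) by apply/numerical_rangeP; exists x.
have wD : c * 'Re (inner (A *m x) x) + s * 'Im (inner (A *m x) x) = D 0 j.
  by rewrite -inner_direction_diag inner_row VHV mxE eqxx.
have zD y : inner y y = 1 -> c * 'Re (inner (A *m y) y) + s * 'Im (inner (A *m y) y)
    = \sum_k D 0 k * `|(V *m y) k 0| ^+ 2.
  by move=> _; rewrite -inner_direction_diag (inner_spectral _ uV VHV).
have one y : inner y y = 1 -> D 0 j = \sum_k D 0 j * `|(V *m y) k 0| ^+ 2.
  by move=> y1; rewrite -mulr_sumr -inner_unitary // y1 mulr1.
have [lo|hi] := ext j.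
  apply: (boundary_of_support cR sR cs0 wW) => z /numerical_rangeP[y y1 <-].
  rewrite wD zD // (one y y1); apply: ler_sum => k _.
  by rewrite ler_wpM2r ?exprn_ge0 // lo.
apply: (@boundary_of_support _ _ A (- c) (- s)) => //; rewrite ?rpredN ?oppr_eq0 //.
move=> z /numerical_rangeP[y y1 <-].
rewrite !mulNr -!opprD lerN2 wD zD // (one y y1); apply: ler_sum => k _.
by rewrite ler_wpM2r ?exprn_ge0 // hi.
Qed.

(** Real coordinates of [P] give a real direction, shared by [Q] up to a factor; the two orders are
    multiplicities of distinct eigenvalues, and their sum leaves room for no third one. *)
Lemma boundary_family_of_base_points A P Q :
  on_base_curve A P -> on_base_curve A Q -> real_point P -> real_point Q ->
  ~ same_point P Q -> collinear origin P Q ->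
  (ord_base_curve A P + ord_base_curve A Q)%N = n ->
  exists x : 'I_n -> 'cV[C]_n, boundary_family A x.
Proof.
(* The zero direction, diagonalized by the identity, evaluates the base polynomial at (0 : 0 : t) as
   t^n, so the origin is not on the curve. *)
have one_spec : 1%:M *m direction A 0 0 *m (1%:M : 'M[C]_n)^t* = diag_mx 0.
  by rewrite /direction !scale0r addr0 mulmx0 mul0mx linear0.
have u1 : (1%:M : 'M[C]_n) \is unitarymx by apply/unitarymxP; rewrite trmx1 map_mx1 mulmx1.
have not_origin T : on_base_curve A T -> (T 0 0 != 0) || (T 0 1 != 0).
  move=> [/eqP T0 BT]; apply: contra_notT T0; rewrite negb_or !negbK => /andP[/eqP t0 /eqP t1].
  apply: row3P; rewrite ?t0 ?t1 mxE //.
  have := BT; rewrite (meval_base_poly_direction (m := 0) u1 one_spec) ?mul0r //.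
  by move=> /eqP /prodf_eq0[i _]; rewrite mul0r add0r => /eqP.
move=> cP cQ [a a0 aP] [b b0 bQ] nPQ [l l0 [lO lP lQ]] ordn.
have l2 : l 2 0 = 0.
  by move/mxdot3: lO; rewrite !mxE /= !mul0r !add0r mul1r.
have lne : (l 0 0 != 0) || (l 1 0 != 0).
  apply: contraNT l0; rewrite negb_or !negbK => /andP[/eqP l00 /eqP l10].
  apply/eqP/trmx_inj/row3P; by rewrite !mxE.
move/mxdot3: lP; move/mxdot3: lQ; rewrite l2 !mulr0 !addr0 => lQ lP.
have neP := not_origin P cP; have neQ := not_origin Q cQ.
have cross : P 0 0 * Q 0 1 - P 0 1 * Q 0 0 = 0.
  case/orP: lne => [l00|l10].
    apply: (mulfI l00); rewrite mulr0.
    transitivity (Q 0 1 * (P 0 0 * l 0 0 + P 0 1 * l 1 0)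
      - P 0 1 * (Q 0 0 * l 0 0 + Q 0 1 * l 1 0)); first by ring.
    by rewrite lP lQ !mulr0 subrr.
  apply: (mulfI l10); rewrite mulr0.
  transitivity (P 0 0 * (Q 0 0 * l 0 0 + Q 0 1 * l 1 0)
    - Q 0 0 * (P 0 0 * l 0 0 + P 0 1 * l 1 0)); first by ring.
  by rewrite lP lQ !mulr0 subrr.
have [e Q0 Q1] := parallel_scale neP cross.
have e0 : e != 0 by apply: contraTneq neQ => e0; rewrite Q0 Q1 e0 !mul0r eqxx.
have aPR k : a * P 0 k \is Num.real by have /mxOverP/(_ 0 k) := aP; rewrite mxE.
have bQR k : b * Q 0 k \is Num.real by have /mxOverP/(_ 0 k) := bQ; rewrite mxE.
pose c := a * P 0 0; pose s := a * P 0 1.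
have cs0 : (c != 0) || (s != 0) by rewrite !mulf_eq0 (negPf a0).
have P0c : P 0 0 = a^-1 * c by rewrite mulKf.
have P1s : P 0 1 = a^-1 * s by rewrite mulKf.
have Q0c : Q 0 0 = e * a^-1 * c by rewrite -mulrA mulKf.
have Q1s : Q 0 1 = e * a^-1 * s by rewrite -mulrA mulKf.
have [V [D [uV VHV]]] := direction_spectral A (aPR 0) (aPR 1).
(* These solve [a^-1 * D + P 0 2 = 0] and [e * a^-1 * D + Q 0 2 = 0] for the eigenvalue [D]. *)
pose tP := - (a * P 0 2); pose tQ := - (a / e * Q 0 2).
have a'0 : a^-1 != 0 by rewrite invr_eq0.
have ea0 : e * a^-1 != 0 by rewrite mulf_neq0.
have oP : ord_base_curve A P = #|[pred i | D 0 i == tP]|.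
  rewrite (ord_base_curve_direction uV VHV P0c P1s).
  apply: eq_card => i; rewrite !inE -[RHS](inj_eq (mulfI a'0)) -[RHS]subr_eq0 /tP.
  by rewrite mulrN opprK mulKf.
have oQ : ord_base_curve A Q = #|[pred i | D 0 i == tQ]|.
  rewrite (ord_base_curve_direction uV VHV Q0c Q1s).
  apply: eq_card => i; rewrite !inE -[RHS](inj_eq (mulfI ea0)) -[RHS]subr_eq0 /tQ.
  rewrite mulrN opprK mulrA (_ : e * a^-1 * (a / e) = 1) ?mul1r //.
  by field; rewrite a0 e0.
have tPQ : tP != tQ.
  apply: contra_not_neq nPQ => tE; exists e => //.
  apply: row3P; rewrite !mxE //.
  apply: (mulfI (mulf_neq0 a0 (invr_neq0 e0))).
  rewrite -[LHS]opprK -/tQ -tE opprK mulrA.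
  by congr (_ * _); rewrite divfK.
(* The index sets of the two eigenvalues are disjoint and their sizes add up to [n], so they exhaust
   the indices. *)
have cover i : D 0 i = tP \/ D 0 i = tQ.
  have : i \in [predU [pred i | D 0 i == tP] & [pred i | D 0 i == tQ]].
    suff /subset_cardP : #|[predU [pred i | D 0 i == tP] & [pred i | D 0 i == tQ]]| = #|'I_n|.
      by move=> /(_ (subset_predT _)) ->.
    rewrite card_ord -[RHS]ordn oP oQ -cardUI [X in (_ + X)%N]eq_card0 ?addn0 //.
    move=> k; rewrite !inE; apply/negP => /andP[/eqP kP /eqP kQ].
    by rewrite -kP -kQ eqxx in tPQ.
  by rewrite !inE => /orP[]/eqP; [left|right].
have DR j : D 0 j \is Num.real.
  have -> : D 0 j = (V *m direction A c s *m V^t* ) j j by rewrite VHV mxE eqxx.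
  by rewrite -inner_row; apply/CrealP; apply: inner_direction_conj; exact: aPR.
exists (fun j => (row j V)^t* ).
apply: (boundary_family_of_spectral (aPR 0) (aPR 1) cs0 uV VHV) => j.
(* [t] is the other candidate value; if it is not attained, [D] is constant, and otherwise the two
   values are comparable because they are real. *)
have [t Dk] : exists t, forall k, D 0 k = D 0 j \/ D 0 k = t.
  by case: (cover j) => ->; [exists tQ|exists tP] => k; case: (cover k); tauto.
have [[i Di]|none] := pselect (exists i, D 0 i = t); last first.
  left=> k; case: (Dk k) => [->|Dkj] //; by case: none; exists k.
have /orP[le|le] := real_leVge (DR j) (DR i); [left|right] => k;
  by case: (Dk k) => ->; rewrite -?Di.
Qed.

End Proposition.

Theorem proposition11 (R : realType) (n : nat) (hn : (2 <= n)%N)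
    (A : 'M[R[i]]_n) (hA : unitarily_irreducible A) :
  gau_wu_number A = n <->
  exists P Q : 'rV[R[i]]_3,
    [/\ on_base_curve A P /\ on_base_curve A Q,
        real_point P /\ real_point Q,
        ~ same_point P Q,
        collinear origin P Q &
        (ord_base_curve A P + ord_base_curve A Q)%N = n].
Proof.
rewrite gau_wu_number_eq_size; split=> [[x]|[P [Q [[cP cQ] [rP rQ] nPQ col ordn]]]].
  exact: base_points_of_boundary_family hn hA (@boundary_support _ _ A).
exact: boundary_family_of_base_points ordn.
Qed.
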